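(* Let $\Gamma=(V,E)$ be a simple graph of order $n$ and maximum degree $\Delta$. For every $k\in\{0,\dots,\Delta\}$, $$\phi_k^{go}(\Gamma)\ \ge\ \left\lfloor\frac{n}{2}\right\rfloor+\left\lfloor\frac{k}{2}\right\rfloor-1 .$$
   Context: For $S\subseteq V$ and $v\in V$, $\delta_S(v)$ denotes the number of neighbors of $v$ in $S$, and $\overline{S}=V\setminus S$. The boundary $\partial S$ is the set of vertices of $\overline{S}$ having at least one neighbor in $S$. For an integer $k$, a nonempty set $S\subseteq V$ is an offensive $k$-alliance if $\delta_S(v)\ge\delta_{\overline{S}}(v)+k$ for every $v\in\partial S$ (vacuously true when $S=V$). It is a global offensive $k$-alliance if, in addition, $S$ is a dominating set (every vertex of $\overline{S}$ has a neighbor in $S$). A set $X\subseteq V$ is global offensive $k$-alliance free ($k$-goaf) if no subset of $X$ is a global offensive $k$-alliance. $\phi_k^{go}(\Gamma)$ denotes the largest cardinality of a $k$-goaf set in $\Gamma$. *)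

(* Defs.v *)
(* A simple graph is a symmetric irreflexive relation on a
   finite type of vertices. *)
From HB Require Import structures.
From mathcomp Require Import all_boot all_order all_algebra.

Set Implicit Arguments.
Unset Strict Implicit.
Unset Printing Implicit Defensive.

Import Order.TTheory GRing.Theory Num.Theory.

Section Alliances.

Variables (V : finType) (e : rel V).
Implicit Types (S X : {set V}) (k : int) (v : V).

Definition deg_in S v : nat := #|[set u in S | e v u]|.

(* 0 on a graph without vertices *)
Definition max_degree : nat := \max_(v : V) deg_in [set: V] v.

Definition boundary S : {set V} :=
  [set v in ~: S | [exists u in S, e v u]].

Definition offensive_alliance k S : bool :=
  (S != set0) &&
  [forall v in boundary S,
     ((deg_in (~: S) v)%:Z + k <= (deg_in S v)%:Z)%R].

Definition dominating S : bool :=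
  [forall v in ~: S, [exists u in S, e v u]].

Definition global_offensive_alliance k S : bool :=
  offensive_alliance k S && dominating S.

Definition goaf k X : bool :=
  [forall S : {set V}, (S \subset X) ==> ~~ global_offensive_alliance k S].

(* The maximum ranges over a nonempty family: set0 is always free, since
   alliances are nonempty. *)
Definition phi_go k : nat := \max_(X : {set V} | goaf k X) #|X|.

End Alliances.

(* Main.v *)
Require Import Defs.
From HB Require Import structures.
From mathcomp Require Import all_boot all_order all_algebra.
From mathcomp Require Import zify.

Set Implicit Arguments.
Unset Strict Implicit.
Unset Printing Implicit Defensive.

Import Order.TTheory GRing.Theory Num.Theory.

(** A single vertex [v] outside [X] suffices to prevent every subset of [X]
    from being a global offensive [k]-alliance.  Indeed, passing from [S] to a
    larger set avoiding [v] only moves neighbours of [v] to the favourable side,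
    so a violation of the alliance inequality at [v] by [X] is inherited by all
    [S] inside [X]; likewise if [v] is not dominated by [X] ([goaf_witness]).

    It remains to choose a large such [X].  Let [v] have degree [d] and let [X]
    be the complement of [v] together with [b] of its neighbours.  Then [v] has
    [d - b] neighbours in [X] and [b] outside, so [X] is free as soon as
    [d < 2 * b + k], or else [b = d] ([goaf_setC]).  The least admissible [b] is
    at most [(d - k)./2 + 1], so for [v] of maximum degree, where [k <= d], the
    set [X] has at least [n - 2 - (d - k)./2] elements; as [d <= n - 1], this
    is at least [n./2 + k./2 - 1]. *)

Lemma exists_subset_card (T : finType) (A : {set T}) (m : nat) :
  m <= #|A| -> exists2 B : {set T}, B \subset A & #|B| = m.
Proof.
move=> /card_geqP[s [s_uniq <- sA]]; exists [set x in s].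
  by apply/subsetP=> x; rewrite inE; apply: sA.
by rewrite cardsE; apply/card_uniqP.
Qed.

Section FreeSets.

Variables (V : finType) (e : rel V).
Implicit Types (S X B : {set V}) (v : V).

Lemma deg_inS S X v : S \subset X -> deg_in e S v <= deg_in e X v.
Proof.
move=> sSX; apply: subset_leq_card; apply/subsetP=> u.
by rewrite !inE => /andP[/(subsetP sSX)-> ->].
Qed.

Lemma deg_in_setC S v :
  deg_in e S v + deg_in e (~: S) v = deg_in e [set: V] v.
Proof.
rewrite /deg_in -(cardsID S [set u in [set: V] | e v u]).
by congr (_ + _); apply: eq_card => u; rewrite !inE // andbC.
Qed.

Lemma deg_in_lt_order v : irreflexive e -> deg_in e [set: V] v < #|V|.
Proof.
move=> e_irr; rewrite -cardsT; apply: proper_card; apply/properP.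
by split; [apply: subsetT | exists v; rewrite !inE // e_irr].
Qed.

(** Shrinking [X] to [S] can only lower the number of neighbours of [v] inside
    and raise the number outside, so both obstructions pass to subsets.  Since
    a global alliance dominates [v], the vertex [v] is on the boundary of [S],
    where the alliance inequality is required. *)
Lemma goaf_witness (k : int) X v : v \notin X ->
  deg_in e X v = 0 \/ ((deg_in e X v)%:Z < (deg_in e (~: X) v)%:Z + k)%R ->
  goaf e k X.
Proof.
move=> vX obstr; apply/forallP=> S; apply/implyP=> sSX; apply/negP.
case/andP=> /andP[_ /forallP/(_ v)/implyP off] /forallP/(_ v)/implyP dom.
have vS : v \in ~: S by rewrite inE; apply: contra vX; apply: (subsetP sSX).
have /exists_inP[u uS evu] := dom vS.
have {}off : ((deg_in e (~: S) v)%:Z + k <= (deg_in e S v)%:Z)%R.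
  by apply: off; rewrite inE vS; exact: dom.
have leS := deg_inS v sSX.
have leC : deg_in e (~: X) v <= deg_in e (~: S) v by rewrite deg_inS ?setCS.
have deg_gt0 : 0 < deg_in e S v by apply/card_gt0P; exists u; rewrite inE uS.
by case: obstr; lia.
Qed.

Lemma goaf_setC (k : nat) v B : irreflexive e ->
  B \subset [set u | e v u] ->
  #|B| = deg_in e [set: V] v \/ deg_in e [set: V] v < #|B|.*2 + k ->
  goaf e k%:Z (~: (v |: B)).
Proof.
move=> e_irr sBN obstr; set X := ~: _.
have out : deg_in e (~: X) v = #|B|.
  rewrite /deg_in setCK; apply: eq_card => u; rewrite !inE.
  case: eqP => [->|_] /=; last first.
    by apply: andb_idr => /(subsetP sBN); rewrite inE.
  by rewrite e_irr; apply/esym/negP => /(subsetP sBN); rewrite inE e_irr.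
have sum := deg_in_setC X v.
by apply: (@goaf_witness _ _ v); [rewrite !inE eqxx | case: obstr; lia].
Qed.

(** The value [(d - k)./2.+1] is the least [b] with [d < 2 * b + k].  The
    minimum matters only when [d = k = 0], where there is no neighbour to
    remove, but the complement of [v] already fails to dominate [v]. *)
Lemma phi_go_ge_deg (k : nat) v (d := deg_in e [set: V] v) :
  irreflexive e ->
  k <= d -> #|V| <= phi_go e k%:Z + (minn d (d - k)./2.+1).+1.
Proof.
move=> e_irr le_kd; set b := minn _ _.
have deg_nbhd : d = #|[set u | e v u]| by apply: eq_card => u; rewrite !inE.
have [|B sBN cardB] := @exists_subset_card _ [set u | e v u] b.
  by rewrite -deg_nbhd geq_minl.
have freeX : goaf e k%:Z (~: (v |: B)).
  by apply: goaf_setC => //; rewrite cardB -/d; lia.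
have leX : #|~: (v |: B)| <= phi_go e k%:Z by exact: leq_bigmax_cond.
have := cardsC (v |: B); have := cardsU1 v B; lia.
Qed.

End FreeSets.

Theorem theorem17 (V : finType) (e : rel V) (e_sym : symmetric e)
    (e_irr : irreflexive e) (k : nat) (hk : k <= max_degree e) :
  ((#|V|./2)%:Z + (k./2)%:Z - 1 <= (phi_go e k%:Z)%:Z)%R.
Proof.
case: (posnP #|V|) => [V0 | V_gt0].
  have max0 : max_degree e = 0.
    by rewrite /max_degree big1 // => v; have := card0_eq V0 v; rewrite inE.
  move: hk; rewrite max0 leqn0 => /eqP->; rewrite V0; lia.
have [v max_v] := @bigop.eq_bigmax _ (deg_in e [set: V]) V_gt0.
move: hk; rewrite /max_degree max_v => le_kd.
have := phi_go_ge_deg e_irr le_kd; have := deg_in_lt_order v e_irr; lia.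
Qed.
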